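(* Let $n\ge 2$, let $\mathbb F$ be a field, and let $\mathfrak S$ be a line-spread of $\mathrm{PG}(n,\mathbb F)$ which admits a dual. For a point $p$ of $\mathrm{PG}(n,\mathbb F)$ let $\ell_p$ be the member of $\mathfrak S$ containing $p$. Then the set $$\mathcal H_{\mathfrak S}=\{(p,H)\mid (p,H)\text{ a point of }A_{n,\{1,n\}}(\mathbb F),\ \ell_p\subseteq H\}$$ is a geometric hyperplane of $A_{n,\{1,n\}}(\mathbb F)$.
   Context: $A_{n,\{1,n\}}(\mathbb F)$ is the point-line geometry whose points are the pairs $(p,H)$ with $p$ a point and $H$ a hyperplane of $\mathrm{PG}(n,\mathbb F)$ such that $p\in H$; its lines are the sets $\{(p,H)\mid p\in\ell\}$ for $\ell$ a line and $H$ a hyperplane with $\ell\subseteq H$, and the sets $\{(p,H)\mid H\supseteq L\}$ for $L$ a subspace of codimension $2$ and $p\in L$. A subspace is a set $X$ of points such that every line meeting $X$ in at least two points lies in $X$; a geometric hyperplane is a proper subspace meeting every line. A line-spread of $\mathrm{PG}(n,\mathbb F)$ is a set of lines such that every point lies on exactly one of them. A dual line-spread is a set $\mathfrak S^*$ of codimension-$2$ subspaces (sub-hyperplanes) such that every hyperplane contains exactly one member of $\mathfrak S^*$. A line-spread $\mathfrak S$ admits a dual if there is a dual line-spread $\mathfrak S^*$ such that for every $L\in\mathfrak S^*$ the members of $\mathfrak S$ contained in $L$ form a line-spread of the projective space $L$ (for $L$ of dimension $1$, $\{L\}$ is regarded as its unique line-spread). *)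

(* Defs.v *)
From mathcomp Require Import all_boot all_order all_algebra.
From mathcomp Require Import boolp classical_sets.

Set Implicit Arguments.
Unset Strict Implicit.
Unset Printing Implicit Defensive.

Import GRing.Theory.

Local Open Scope classical_set_scope.
Local Open Scope ring_scope.

Record point_line_geometry (T : Type) := PointLineGeometry {
  points : set T;
  lines : set (set T)
}.

Definition geom_subspace (T : Type) (G : point_line_geometry T) (X : set T) :
    Prop :=
  X `<=` points G /\
  forall A, lines G A ->
    (exists x y, [/\ x <> y, (A `&` X) x & (A `&` X) y]) -> A `<=` X.

Definition geom_hyperplane (T : Type) (G : point_line_geometry T) (X : set T) :
    Prop :=
  [/\ geom_subspace G X, X <> points G &
      forall A, lines G A -> exists x, (A `&` X) x].

Section ProjectiveSpace.
Variables (F : fieldType) (n : nat).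

(* Subspaces of PG(n, F) are the vector subspaces of F^(n+1); the projective
   dimension is the vector dimension minus one, and incidence is (_ <= _)%VS. *)
Definition pg_sub := {vspace 'rV[F]_n.+1}.

Definition pg_point (U : pg_sub) : Prop := \dim U = 1%N.
Definition pg_line (U : pg_sub) : Prop := \dim U = 2%N.
Definition pg_codim (k : nat) (U : pg_sub) : Prop := (\dim U + k = n.+1)%N.
Definition pg_hyperplane (U : pg_sub) : Prop := pg_codim 1 U.
Definition pg_subhyperplane (U : pg_sub) : Prop := pg_codim 2 U.

(* A_{n,{1,n}}(F) *)
Definition A1n_points : set (pg_sub * pg_sub) :=
  [set x | [/\ pg_point x.1, pg_hyperplane x.2 & (x.1 <= x.2)%VS]].

Definition A1n_line_pt (l H : pg_sub) : set (pg_sub * pg_sub) :=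
  [set x | [/\ pg_point x.1, (x.1 <= l)%VS & x.2 = H]].

Definition A1n_line_hyp (p L : pg_sub) : set (pg_sub * pg_sub) :=
  [set x | [/\ x.1 = p, pg_hyperplane x.2 & (L <= x.2)%VS]].

Definition A1n_lines : set (set (pg_sub * pg_sub)) :=
  [set A | (exists l H, [/\ pg_line l, pg_hyperplane H, (l <= H)%VS &
                            A = A1n_line_pt l H]) \/
           (exists p L, [/\ pg_point p, pg_subhyperplane L, (p <= L)%VS &
                            A = A1n_line_hyp p L])].

Definition A1n : point_line_geometry (pg_sub * pg_sub) :=
  PointLineGeometry A1n_points A1n_lines.

(* S is a line-spread of the projective space on U.  When U is itself a line,
   this forces S = [set U]. *)
Definition line_spread_in (U : pg_sub) (S : set pg_sub) : Prop :=
  (forall l, S l -> pg_line l /\ (l <= U)%VS) /\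
  (forall p, pg_point p -> (p <= U)%VS -> exists! l, S l /\ (p <= l)%VS).

Definition line_spread (S : set pg_sub) : Prop := line_spread_in fullv S.

Definition dual_line_spread (Sd : set pg_sub) : Prop :=
  (forall L, Sd L -> pg_subhyperplane L) /\
  (forall H, pg_hyperplane H -> exists! L, Sd L /\ (L <= H)%VS).

Definition admits_dual (S : set pg_sub) : Prop :=
  exists2 Sd, dual_line_spread Sd &
    forall L, Sd L -> line_spread_in L [set l | S l /\ (l <= L)%VS].

(* The member of S through p; the default value 0 is never used when S is a
   line-spread and p a point (spread_lineP). *)
Definition spread_line (S : set pg_sub) (p : pg_sub) : pg_sub :=
  xget 0%VS [set l | S l /\ (p <= l)%VS].

Definition spread_hyperplane (S : set pg_sub) : set (pg_sub * pg_sub) :=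
  [set x | A1n_points x /\ (spread_line S x.1 <= x.2)%VS].

Lemma spread_lineP (S : set pg_sub) (p l : pg_sub) :
  line_spread S -> pg_point p -> (S l /\ (p <= l)%VS) <-> l = spread_line S p.
Proof.
move=> [_ Sp] pp; have [m [Sm um]] := Sp p pp (subvf p).
have -> : spread_line S p = m.
  by apply: xget_unique => // y /um.
by split=> [/um|->].
Qed.

Lemma line_spread_in_line (U : pg_sub) (S : set pg_sub) :
  pg_line U -> line_spread_in U S <-> S = [set U].
Proof.
move=> dU; split=> [[SU Sp]|->].
  have eqU l : S l -> l = U.
    case/SU=> dl lU; apply/eqP; rewrite eqEdim lU /=.
    by rewrite [\dim U]dU [\dim l]dl.
  apply/seteqP; split=> [l /eqU //|_ ->].
  have U0 : U != 0%VS by rewrite -dimv_eq0 [\dim U]dU.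
  have dp : pg_point <[vpick U]>%VS by rewrite /pg_point dim_vline vpick0 U0.
  have [|l [[Sl _] _]] := Sp _ dp; first exact: memv_pick.
  by rewrite -(eqU _ Sl).
split=> [l -> //|p _ pU]; exists U; split=> // l [-> //].
Qed.

End ProjectiveSpace.

(* Main.v *)
Require Import Defs.
From mathcomp Require Import all_boot all_order all_algebra.
From mathcomp Require Import boolp classical_sets zify.

Set Implicit Arguments.
Unset Strict Implicit.
Unset Printing Implicit Defensive.

(** For a hyperplane [H] let [L_H] be the member of the dual spread contained
    in [H].  A spread line [l] contained in [H] meets [L_H] for dimension
    reasons, hence is contained in [L_H], because [L_H] is partitioned by spread
    lines.  So for a point [p] of [H] the condition [l_p <= H] amounts to
    [p <= L_H], and [L_H] is a hyperplane of [H].  This settles the lines with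
    [H] fixed; for those with [p] fixed, the condition that [H] contains [l_p]
    is linear in [H]. *)

Section VectorSpaces.
Variables (K : fieldType) (vT : vectType K).
Implicit Types U V W : {vspace vT}.

(** Adjoining a nonzero vector of a complement raises the dimension by exactly one. With [m = n]
    this supplies hyperplanes through a given subspace. *)
Lemma subv_dim_between U (m : nat) :
  (\dim U <= m <= \dim {:vT})%N -> exists2 V, (U <= V)%VS & \dim V = m.
Proof.
elim: m => [|m IH] /andP[leUm lemT].
  by exists U => //; apply/eqP; rewrite -leqn0.
have [eqU|neU] := eqVneq (\dim U) m.+1; first by exists U.
have [|V sUV dV] := IH; first by lia.
have dVC : \dim (V^C)%VS != 0%N by rewrite dimv_compl; lia.
have v0 : vpick (V^C)%VS != 0%R by rewrite vpick0 -dimv_eq0.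
exists (V + <[vpick (V^C)%VS]>)%VS; first exact: subv_trans (addvSl _ _).
rewrite dimv_disjoint_sum ?dV ?dim_vline ?v0 ?addn1 //.
apply/eqP; rewrite -subv0 -(capv_compl V).
by apply: capvS => //; apply: memv_pick.
Qed.

(** Grassmann's formula inside [W] leaves a nonzero intersection, and any nonzero vector of it spans
    a point. *)
Lemma capv_has_point U V W :
  (U <= W)%VS -> (V <= W)%VS -> (\dim W < \dim U + \dim V)%N ->
  exists2 p, \dim p = 1%N & (p <= U :&: V)%VS.
Proof.
move=> sUW sVW ltW.
have leUV : (\dim (U + V) <= \dim W)%N by rewrite dimvS // subv_add sUW.
have dUV := dimv_sum_cap U V.
have nz : \dim (U :&: V)%VS != 0%N by lia.
exists <[vpick (U :&: V)%VS]>%VS; last exact: memv_pick.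
by rewrite dim_vline vpick0 -dimv_eq0 nz.
Qed.

Lemma not_subv_point U V :
  ~~ (U <= V)%VS -> exists p, [/\ \dim p = 1%N, (p <= U)%VS & ~~ (p <= V)%VS].
Proof.
case/subvPn=> v vU vV; exists <[v]>%VS; split=> //.
by rewrite dim_vline; case: eqP vV => // ->; rewrite mem0v.
Qed.

Lemma addv_distinct_points U V W :
  \dim U = 1%N -> \dim V = 1%N -> U <> V -> \dim W = 2%N ->
  (U <= W)%VS -> (V <= W)%VS -> (U + V)%VS = W.
Proof.
move=> dU dV neUV dW sUW sVW; apply/eqP.
rewrite eqEdim subv_add sUW sVW /= dW.
have := dimv_sum_cap U V; have [lt1|ge1] := ltnP (\dim (U :&: V)%VS) 1; first lia.
move=> _; case: neUV; apply/eqP.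
(* If the points met nontrivially, each would lie in the other. *)
have eqUV A B : \dim A = 1%N -> (1 <= \dim (A :&: B))%N -> (A <= B)%VS.
  move=> dA le1; have /eqP <- : (A :&: B)%VS == A.
    by rewrite eqEdim capvSl dA.
  exact: capvSr.
by rewrite eqEsubv !eqUV // capvC.
Qed.

(** Dual to [addv_distinct_points]: were [U :&: V] larger than [W], it would fill both [U] and
    [V]. *)
Lemma capv_distinct_hyperplanes U V W :
  \dim U = (\dim W).+1 -> \dim V = (\dim W).+1 -> U <> V ->
  (W <= U)%VS -> (W <= V)%VS -> (U :&: V)%VS = W.
Proof.
move=> dU dV neUV sWU sWV; apply/eqP; rewrite eq_sym eqEdim subv_cap sWU sWV /=.
rewrite leqNgt; apply/negP=> lt; case: neUV.
have eqL : (U :&: V)%VS = U by apply/eqP; rewrite eqEdim capvSl dU.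
have eqR : (U :&: V)%VS = V by apply/eqP; rewrite eqEdim capvSr dV.
by rewrite -eqL.
Qed.

End VectorSpaces.

Section SpreadHyperplane.
Variables (F : fieldType) (n : nat) (S : set (pg_sub F n)).
Hypothesis spreadS : line_spread S.

Lemma spread_line_spec (p : pg_sub F n) : pg_point p ->
  [/\ S (spread_line S p), pg_line (spread_line S p)
    & (p <= spread_line S p)%VS].
Proof.
move=> pp; have [|Sl pl] := (spread_lineP (spread_line S p) spreadS pp).2 => //.
by split=> //; have [] := spreadS.1 _ Sl.
Qed.

Lemma spread_line_subset (L H p : pg_sub F n) :
  pg_subhyperplane L -> line_spread_in L [set l | S l /\ (l <= L)%VS]%classic ->
  pg_hyperplane H -> (L <= H)%VS -> pg_point p ->
  (spread_line S p <= H)%VS <-> (p <= L)%VS.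
Proof.
rewrite /pg_subhyperplane /pg_hyperplane /pg_codim.
move=> dL [_ SL] dH sLH pp; have [Sl dl pl] := spread_line_spec pp.
(* The spread induced on [L] has a line through [q]; by uniqueness in [S] it is the spread line of
   [q]. *)
have in_L q : pg_point q -> (q <= L)%VS -> (spread_line S q <= L)%VS.
  move=> pq qL; have [l [[[Sl' lL] ql] _]] := SL q pq qL.
  by have <- := (spread_lineP l spreadS pq).1 (conj Sl' ql).
split=> [lH|pL]; last exact: subv_trans (in_L p pp pL) sLH.
(* Vector dimensions 2 and [n - 1] exceed [n] in total, so the two meet inside [H]. The common point
   [q] has the same spread line as [p]. *)
have [|q pq] := capv_has_point lH sLH; first by rewrite [\dim (spread_line _ _)]dl; lia.
rewrite subv_cap => /andP[ql qL]; apply: subv_trans pl _.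
by have -> := (spread_lineP _ spreadS pq).1 (conj Sl ql); exact: in_L.
Qed.

Hypothesis dualS : admits_dual S.

Lemma dual_member (H : pg_sub F n) : pg_hyperplane H ->
  exists L, [/\ pg_subhyperplane L, (L <= H)%VS &
    forall p, pg_point p -> (spread_line S p <= H)%VS <-> (p <= L)%VS].
Proof.
have [Sd [dSd Sd1] SdS] := dualS; move=> hH; have [L [[SL sLH] _]] := Sd1 H hH.
exists L; split=> // [|p]; first exact: dSd.
by apply: spread_line_subset => //; [apply: dSd | apply: SdS].
Qed.

Lemma spread_hyperplane_subspace : geom_subspace (A1n F n) (spread_hyperplane S).
Proof.
split=> [x []//|A]; case=> [[l [H [dl hH sl ->]]]|[p [L [pp dL sp ->]]]].
- case=> -[x x2] [[y y2]] [ne [[/= px xl eqx] [_ /= sx]] [[/= py yl eqy] [_ /= sy]]].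
  subst x2 y2; have [L [dL sLH LP]] := dual_member hH.
  have exy : x <> y by move=> e; apply: ne; rewrite e.
  move: sx sy => /(LP _ px) sx /(LP _ py) sy.
  (* The two given points of [l] lie in [L] and span [l]. *)
  have sl' : (l <= L)%VS.
    by rewrite -(addv_distinct_points px py exy dl xl yl) subv_add sx.
  move=> [z z2] [/= pz zl ->]; split; first by split=> //=; apply: subv_trans sl.
  by apply/(LP _ pz)/(subv_trans zl).
- case=> -[x1 x] [[y1 y]] [ne [[/= ex hx xL] [_ /= sx]] [[/= ey hy yL] [_ /= sy]]].
  subst x1 y1; have exy : x <> y by move=> e; apply: ne; rewrite e.
  move: (hx) (hy) dL; rewrite /pg_subhyperplane /pg_hyperplane /pg_codim => dx dy dL.
  (* Two distinct hyperplanes through [L] meet exactly in [L], so the spread line of [p], lying in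
     both, lies in [L] and hence in every hyperplane of the pencil. *)
  have eL : (x :&: y)%VS = L by apply: capv_distinct_hyperplanes => //; lia.
  have slL : (spread_line S p <= L)%VS by rewrite -eL subv_cap sx.
  move=> [z1 z] [/= -> hz zL]; split; last exact: subv_trans zL.
  by split=> //=; apply: subv_trans zL.
Qed.

Lemma spread_hyperplane_meets_line A : lines (A1n F n) A ->
  exists x, (A `&` spread_hyperplane S)%classic x.
Proof.
case=> [[l [H [dl hH sl ->]]]|[p [L [pp dL sp ->]]]].
- have [L [dL sLH LP]] := dual_member hH.
  have [|q pq] := capv_has_point sl sLH.
    by move: dL hH; rewrite /pg_subhyperplane /pg_hyperplane /pg_codim [\dim l]dl; lia.
  rewrite subv_cap => /andP[ql qL]; exists (q, H); split; first by split.
  by split; [split=> //=; apply: subv_trans sl | apply/LP].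
- have [Sl dl pl] := spread_line_spec pp.
  (* As [L] and the spread line share [p], their sum has vector dimension at most
     [(n - 1) + 2 - 1 = n] and fits in a hyperplane. *)
  have [|H] := @subv_dim_between _ _ (L + spread_line S p)%VS n.
    have := dimv_sum_cap L (spread_line S p).
    have : (\dim p <= \dim (L :&: spread_line S p))%N by rewrite dimvS // subv_cap sp.
    move: dL; rewrite dimvf /dim /= mul1n /pg_subhyperplane /pg_codim.
    by rewrite [\dim (spread_line _ _)]dl [\dim p]pp; lia.
  rewrite subv_add => /andP[sLH slH] dH.
  have hH : pg_hyperplane H by rewrite /pg_hyperplane /pg_codim dH addn1.
  by exists (p, H); split; split=> //; split=> //=; apply: subv_trans sLH.
Qed.

Lemma spread_hyperplane_proper : spread_hyperplane S <> points (A1n F n).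
Proof.
have [|H _ dH] := @subv_dim_between _ 'rV[F]_n.+1 0%VS n.
  by rewrite dimv0 dimvf /dim /= mul1n leqnSn.
have hH : pg_hyperplane H by rewrite /pg_hyperplane /pg_codim dH addn1.
have [L [dL sLH LP]] := dual_member hH.
(* A point of [H] off [L] gives a pair [(p, H)] outside the set. *)
have [|p [pp pH pL]] := @not_subv_point _ _ H L.
  apply/negP=> /dimvS; rewrite dH.
  by move: dL; rewrite /pg_subhyperplane /pg_codim; lia.
move=> e; have : points (A1n F n) (p, H) by split.
by rewrite -e => -[_ /= /(LP _ pp)]; apply/negP.
Qed.

End SpreadHyperplane.

Theorem theorem1p12 (F : fieldType) (n : nat) (hn : (2 <= n)%N)
    (S : set (pg_sub F n)) (hS : line_spread S) (hd : admits_dual S) :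
  geom_hyperplane (A1n F n) (spread_hyperplane S).
Proof.
split; first exact: spread_hyperplane_subspace.
- exact: spread_hyperplane_proper.
- exact: spread_hyperplane_meets_line.
Qed.
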